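(* Consider the ATO-POS system with joint returns, and let $\mathcal{I}_0,\mathcal{I}_C\subset\mathcal{I}$ with $\mathcal{I}=\mathcal{I}_0\cup\mathcal{I}_C$ be such that: (i) $\mu>\sum_{i\in\mathcal{I}_0}\lambda_i$; (ii) $\delta_p:=\lambda_p-\mu\left(\sum_{i=1}^pC_i-1\right)>0$ for all $p\in\mathcal{I}_C$; (iii) if $i\in\mathcal{I}_0$ and $j\in\mathcal{I}_C$, then $i\le j$. Then the time $\tau_{\mathrm{Alg}}$ for which all components of the aggregated envelope chain have coupled at least once satisfies $$\mathbb{E}[\tau_{\mathrm{Alg}}]\le\frac{\Lambda}{\mu-\sum_{i\in\mathcal{I}_0}\lambda_i}\sum_{i\in\mathcal{I}_0}C_i+\sum_{p\in\mathcal{I}_C}\frac{\Lambda}{\delta_p}C_p .$$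
   Context: Let $I\ge1$, $\mathcal{I}=\{1,\dots,I\}$, $C=(C_1,\dots,C_I)$ a vector of positive integers, $|C|=\sum_iC_i$, $\mu>0$, $\lambda_A\ge0$ for each nonempty $A\subset\mathcal{I}$, $\lambda=\sum_A\lambda_A$, $\lambda_i=\sum_{A\ni i}\lambda_A$, and $\Lambda=\lambda+\mu|C|$. State space: $\mathcal{N}=\{(n_A)_{\emptyset\ne A\subseteq\mathcal{I}}: n_A\in\mathbb{Z}_{\ge0}\ \forall A,\ \sum_{A\ni i}n_A\le C_i\ \forall i\in\mathcal{I}\}$; for nonempty $A$, $e_A$ is the vector with coordinate $A$ equal to $1$ and the others $0$, and $e_\emptyset=0$. Projected space: $\mathcal{X}=\{0,\dots,C_1\}\times\cdots\times\{0,\dots,C_I\}$ with the product order $\le$, and $\psi:\mathcal{N}\to\mathcal{X}$, $\psi(n)=(\sum_{A\ni i}n_A)_{i\in\mathcal{I}}$. Ordering of subsets: for $i\in\mathcal{I}$ and $0\le k\le2^{I-i}-1$ with binary representation $k=\sum_{s=1}^{I-i}k_s2^{I-i-s}$, $k_s\in\{0,1\}$, let $A^i_k\subset\{i,\dots,I\}$ be the set with $i\in A^i_k$ and, for $s\in\{i+1,\dots,I\}$, $s\in A^i_k$ iff $k_{s-i}=0$. Events $\mathcal{E}$ and transition function $g:\mathcal{N}\times\mathcal{E}\to\mathcal{N}$: - arrivals $d_A$ ($\emptyset\ne A\subset\mathcal{I}$), of probability $\lambda_A/\Lambda$: $g(n,d_A)=n+e_{A^{(n)}}$ with $A^{(n)}=\{i\in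 A:(\psi(n))_i<C_i\}$; - services $r^i_j$ ($i\in\mathcal{I}$, $1\le j\le C_i$), each of probability $\mu/\Lambda$: if $\sum_{\ell=0}^{2^{I-i}-1}n_{A^i_\ell}<j$ then $g(n,r^i_j)=n$; otherwise $g(n,r^i_j)=n-e_{A^i_k}$, where $k$ is the minimal index with $\sum_{\ell=0}^{k-1}n_{A^i_\ell}<j\le\sum_{\ell=0}^{k}n_{A^i_\ell}$. Aggregated envelopes: for $x\in\mathcal{X}$, $a\in\mathcal{E}$, $g^{\inf}(x,a)=\inf\{\psi(g(n,a)):n\in\mathcal{N},\psi(n)=x\}$ and $g^{\sup}(x,a)=\sup\{\psi(g(n,a)):n\in\mathcal{N},\psi(n)=x\}$ (in the lattice $(\mathcal{X},\le)$). For $m\le M$ in $\mathcal{X}$, $$H([m,M],a)=\Big[\inf_{m\le x\le M}g^{\inf}(x,a),\sup_{m\le x\le M}g^{\sup}(x,a)\Big],$$ extended to words of events by successive application from left to right; for a word $w$, $\underline{H}([m,M],w)$ and $\overline{H}([m,M],w)$ denote the lower and upper endpoints of $H([m,M],w)$. Stopping time: let $(a_{-t})_{t\in\mathbb{N}}=(a_0,a_{-1},\dots)$ be i.i.d. events with distribution $\nu$ on $\mathcal{E}$ given by $\nu(d_A)=\lambda_A/\Lambda$ for $\emptyset\ne A\subset\mathcal{I}$ and $\nu(r^i_j)=\mu/\Lambda$ for $i\in\mathcal{I}$, $1\le j\le C_i$, and $a_{-t+1\to-s}=a_{-t+1}\cdots a_{-s}$. With $0$ and $C$ the bottom and top elements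 of $\mathcal{X}$, $\tau_{\mathrm{Alg}}$ is the least $t\ge1$ such that for every $i\in\mathcal{I}$ there is $s\in\{0,\dots,t-1\}$ with $\big(\underline{H}([0,C],a_{-t+1\to-s})\big)_i=\big(\overline{H}([0,C],a_{-t+1\to-s})\big)_i$. *)

(* Defs.v *)
From HB Require Import structures.
From mathcomp Require Import all_boot all_order all_algebra.
From mathcomp Require Import all_classical all_reals all_analysis.

Set Implicit Arguments.
Unset Strict Implicit.
Unset Printing Implicit Defensive.

Import Order.TTheory GRing.Theory Num.Theory.

(* Everything is numbered from 0: component i in {1, ..., I} is the ordinal
   i - 1 of 'I_I, and the index j in {1, ..., C_i} of a service event is the
   ordinal j - 1 of 'I_(C i). *)

Definition demand (I : nat) : finType := {A : {set 'I_I} | A != finset.set0}.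

Definition load (I : nat) (n : {ffun demand I -> nat}) (i : 'I_I) : nat :=
  \sum_(A : demand I | i \in val A) n A.

Definition feasible (I : nat) (C : 'I_I -> nat) (n : {ffun demand I -> nat}) :=
  [forall i, load n i <= C i].

Definition state (I : nat) (C : 'I_I -> nat) :=
  {n : {ffun demand I -> nat} | feasible C n}.

(* e_A; since demands are nonempty, e_set0 is the zero vector *)
Definition unit_vec (I : nat) (A : {set 'I_I}) : {ffun demand I -> nat} :=
  [ffun B : demand I => (val B == A : nat)].

Definition xspace (I : nat) (C : 'I_I -> nat) :=
  {dffun forall i : 'I_I, 'I_(C i).+1}.

HB.instance Definition _ (I : nat) (C : 'I_I -> nat) := Finite.on (xspace C).

Section ProductOrder.
Variables (I : nat) (C : 'I_I -> nat).
Local Open Scope order_scope.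
Implicit Types x y z : xspace C.

Definition space_le x y := [forall i, x i <= y i].
Definition space_meet x y : xspace C := [ffun i => x i `&` y i].
Definition space_join x y : xspace C := [ffun i => x i `|` y i].

Lemma space_le_refl : reflexive space_le.
Proof. by move=> x; apply/forallP. Qed.

Lemma space_le_anti : antisymmetric space_le.
Proof.
move=> x y /andP[/forallP xy /forallP yx]; apply/ffunP => i.
by apply/eqP; rewrite eq_le xy yx.
Qed.

Lemma space_le_trans : transitive space_le.
Proof.
move=> y x z /forallP xy /forallP yz; apply/forallP => i.
exact: le_trans (xy i) (yz i).
Qed.

Fact space_display : Order.disp_t. Proof. exact. Qed.

HB.instance Definition _ := Order.Le_isPOrder.Build space_display (xspace C)
  space_le_refl space_le_anti space_le_trans.

Lemma space_meetP x y z : (x <= space_meet y z) = (x <= y) && (x <= z).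
Proof.
apply/forallP/andP => [h|[/forallP xy /forallP xz] i]; last first.
  by rewrite ffunE lexI xy xz.
by split; apply/forallP => i; have := h i; rewrite ffunE lexI => /andP[].
Qed.

Lemma space_joinP x y z : (space_join x y <= z) = (x <= z) && (y <= z).
Proof.
apply/forallP/andP => [h|[/forallP xz /forallP yz] i]; last first.
  by rewrite ffunE leUx xz yz.
by split; apply/forallP => i; have := h i; rewrite ffunE leUx => /andP[].
Qed.

HB.instance Definition _ := Order.POrder_MeetJoin_isLattice.Build
  space_display (xspace C) space_meetP space_joinP.

Lemma space_bot x : ([ffun i => \bot] : xspace C) <= x.
Proof. by apply/forallP => i; rewrite ffunE le0x. Qed.

Lemma space_top x : x <= ([ffun i => \top] : xspace C).
Proof. by apply/forallP => i; rewrite ffunE lex1. Qed.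

HB.instance Definition _ := Order.hasBottom.Build
  space_display (xspace C) space_bot.
HB.instance Definition _ := Order.hasTop.Build
  space_display (xspace C) space_top.

End ProductOrder.

Section Dynamics.
Variables (I : nat) (C : 'I_I -> nat).

Lemma load_lt (n : state C) (i : 'I_I) : load (val n) i < (C i).+1.
Proof. by rewrite ltnS; have /forallP := valP n. Qed.

Definition psi (n : state C) : xspace C := [ffun i => Ordinal (load_lt n i)].

Definition event : finType := (demand I + {i : 'I_I & 'I_(C i)})%type.
Definition arrival (A : demand I) : event := inl A.
Definition service (i : 'I_I) (j : 'I_(C i)) : event :=
  inr (existT (fun i => 'I_(C i)) i j).

Definition accepted (n : state C) (A : demand I) : {set 'I_I} :=
  finset (fun i => (i \in val A) && (psi n i < C i)).

Definition arrive (n : state C) (A : demand I) : {ffun demand I -> nat} :=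
  [ffun B => val n B + unit_vec (accepted n A) B].

Lemma load_unit_vec (A : {set 'I_I}) (i : 'I_I) :
  load (unit_vec A) i = (i \in A).
Proof.
rewrite /load; have [->|A0] := eqVneq A finset.set0.
  by rewrite inE big1// => B _; rewrite ffunE (negbTE (valP B)).
pose A' : demand I := Sub A A0.
have e B : unit_vec A B = (B == A') by rewrite ffunE -val_eqE.
case: (boolP (i \in A)) => iA.
  rewrite (bigD1 A') ?SubK//= e eqxx big1// => B /andP[_ /negbTE].
  by rewrite e => ->.
rewrite big1// => B iB; rewrite e.
by case: eqP => // BA'; move: iB; rewrite BA' SubK (negbTE iA).
Qed.

Lemma arrive_feasible n A : feasible C (arrive n A).
Proof.
apply/forallP => i; rewrite /load.
under eq_bigr do rewrite ffunE.
rewrite big_split/= -/(load _ i) -/(load (unit_vec _) i) load_unit_vec.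
rewrite inE ffunE /=; have := load_lt n i; rewrite ltnS => le_nC.
case: (_ \in _) => /=; last by rewrite addn0.
by case: ltnP => h; rewrite ?addn1 ?addn0.
Qed.

(* The subset A^i_k: the digit k_{s-i} of k, which is the one of weight
   2 ^ (I - s) with the components numbered from 1, decides on membership of
   s > i. *)
Definition returnset (i : 'I_I) (k : nat) : {set 'I_I} :=
  finset (fun s : 'I_I =>
    (s == i) || ((i < s) && ~~ odd (k %/ 2 ^ (I - s.+1)))).

Lemma returnset_neq0 i k : returnset i k != finset.set0.
Proof. by apply/finset.set0Pn; exists i; rewrite inE eqxx. Qed.

Definition return_demand (i : 'I_I) (k : nat) : demand I :=
  Sub (returnset i k) (returnset_neq0 i k).

Definition cumul (n : state C) (i : 'I_I) (k : nat) : nat :=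
  \sum_(0 <= l < k) val n (return_demand i l).

(* The rank of the unit is j.+1, and [find] yields the minimal index k; the
   subtraction in [depart] does not underflow, as cumul jumps at k. *)
Definition return_index (n : state C) (i : 'I_I) (j : nat) : nat :=
  find (fun k => cumul n i k < j.+1 <= cumul n i k.+1)
    (iota 0 (2 ^ (I - i.+1))).

Definition depart (n : state C) (i : 'I_I) (j : nat) : {ffun demand I -> nat} :=
  if cumul n i (2 ^ (I - i.+1)) < j.+1 then val n
  else [ffun B => val n B - unit_vec (returnset i (return_index n i j)) B].

Lemma depart_feasible n i j : feasible C (depart n i j).
Proof.
rewrite /depart; case: ifP => _; first exact: (valP n).
apply/forallP => l; apply: leq_trans (_ : load (val n) l <= _); last first.
  by rewrite -ltnS load_lt.
by apply: leq_sum => B _; rewrite ffunE leq_subr.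
Qed.

Definition g (n : state C) (a : event) : state C :=
  match a with
  | inl A => Sub (arrive n A) (arrive_feasible n A)
  | inr (existT i j) => Sub (depart n i j) (depart_feasible n i j)
  end.

End Dynamics.

Section Envelopes.
Variables (I : nat) (C : 'I_I -> nat).
Implicit Types (x m M : xspace C) (a : event C).
Local Open Scope order_scope.
Local Open Scope classical_set_scope.

Definition successors x a : set (xspace C) :=
  [set psi (g n a) | n in [set n : state C | psi n = x]].

Definition g_inf x a : xspace C := \meet_(y in successors x a) y.
Definition g_sup x a : xspace C := \join_(y in successors x a) y.

(* the interval [m, M] is represented by the pair (m, M) *)
Definition envelope (mM : xspace C * xspace C) a : xspace C * xspace C :=
  (\meet_(x | mM.1 <= x <= mM.2) g_inf x a,
   \join_(x | mM.1 <= x <= mM.2) g_sup x a).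

Definition envelope_word (mM : xspace C * xspace C) (w : seq (event C)) :=
  foldl envelope mM w.

End Envelopes.

(* Below, [a t] stands for the event a_{-t}. *)

(* a_{-t+1} ... a_{-s}, the oldest event first *)
Definition past_word (E : Type) (a : nat -> E) (t s : nat) : seq E :=
  [seq a k | k <- rev (iota s (t - s))].

Definition all_coupled (I : nat) (C : 'I_I -> nat) (a : nat -> event C)
    (t : nat) : bool :=
  [forall i : 'I_I, [exists s : 'I_t,
    let H := envelope_word (\bot%O, \top%O) (past_word a t s) in
    H.1 i == H.2 i]].

Definition tau_alg (R : realType) (I : nat) (C : 'I_I -> nat)
    (a : nat -> event C) : \bar R :=
  match pselect (exists t, (0 < t) && all_coupled a t) with
  | left ex => ((ex_minn ex)%:R)%:E
  | right _ => +oo%E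
  end.

Section Probability.
Local Open Scope ring_scope.

Definition rate_total (R : realType) (I : nat) (lambda : demand I -> R) : R :=
  \sum_(A : demand I) lambda A.

Definition rate_of (R : realType) (I : nat) (lambda : demand I -> R)
    (i : 'I_I) : R :=
  \sum_(A : demand I | i \in val A) lambda A.

Definition Lambda (R : realType) (I : nat) (C : 'I_I -> nat)
    (lambda : demand I -> R) (mu : R) : R :=
  rate_total lambda + mu * (\sum_i C i)%:R.

Definition nu (R : realType) (I : nat) (C : 'I_I -> nat)
    (lambda : demand I -> R) (mu : R) (e : event C) : R :=
  match e with
  | inl A => lambda A / Lambda C lambda mu
  | inr _ => mu / Lambda C lambda mu
  end.

Definition delta (R : realType) (I : nat) (C : 'I_I -> nat)
    (lambda : demand I -> R) (mu : R) (p : 'I_I) : R :=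
  rate_of lambda p - mu * ((\sum_(i < I | (i <= p)%N) C i)%:R - 1).

(* i.i.d. random variables with values in a finite type E (with the discrete
   sigma-algebra), of common probability mass function q *)
Record iid_seq (d : measure_display) (T : measurableType d) (R : realType)
    (P : probability T R) (E : finType) (q : E -> R) (a : nat -> T -> E) :
    Prop := IidSeq {
  iid_measurable : forall t (B : set E), measurable (a t @^-1` B)%classic;
  iid_law : forall t e, P (a t @^-1` [set e])%classic = (q e)%:E;
  iid_independent : forall (J : seq nat) (B : nat -> set E), uniq J ->
    P (\bigcap_(t in [set` J]) (a t @^-1` B t))%classic =
    (\prod_(t <- J) P (a t @^-1` B t)%classic)%E }.

End Probability.

(* Main.v *)
(* Let m and M be the lower and upper endpoints of the envelope. For p in IC the
   deficit C_p - m_p decreases in mean by at least delta_p / Lambda as long as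
   it is positive, and component p is coupled once it vanishes. For I0 the total
   sum_{i in I0} M_i decreases in mean by at least
   (mu - sum_{i in I0} lambda_i) / Lambda as long as it is positive, and all of
   I0 is coupled once it vanishes. Foster's criterion bounds the mean hitting
   times. Since the letters are i.i.d., the backward word a_{-t+1} ... a_0 has
   the law of a forward word of length t, so P(tau > t) is at most the sum over
   the hitting times of the probability that the forward chain has not hit by
   time t. *)

Require Import Defs.
From mathcomp Require Import all_boot all_order all_algebra.
From mathcomp Require Import all_classical all_reals all_analysis.
From mathcomp Require Import zify ring lra.

Set Implicit Arguments.
Unset Strict Implicit.
Unset Printing Implicit Defensive.

Import Order.TTheory GRing.Theory Num.Theory.
Local Open Scope ring_scope.

(** * Effect of a single event on the loads *)

Section Dynamics.
Local Open Scope nat_scope.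

Lemma binary_digits_inj N k l : k < 2 ^ N -> l < 2 ^ N ->
  (forall b, b < N -> odd (k %/ 2 ^ b) = odd (l %/ 2 ^ b)) -> k = l.
Proof.
elim: N k l => [|N IHN] k l; first by rewrite expn0; lia.
rewrite expnS => kN lN kl.
have := kl 0 isT; rewrite expn0 !divn1 => kl0.
have /IHN : k %/ 2 < 2 ^ N by lia.
move=> /(_ (l %/ 2)); have -> : l %/ 2 < 2 ^ N by lia.
move=> /(_ isT) E; suff : k %/ 2 = l %/ 2 by lia.
by apply: E => b bN; rewrite -!divnMA -expnS kl.
Qed.

Lemma binary_digits_ex N (f : nat -> bool) :
  exists2 k, k < 2 ^ N & forall b, b < N -> odd (k %/ 2 ^ b) = f b.
Proof.
elim: N f => [|N IHN] f; first by exists 0.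
have [k kN kf] := IHN (fun b => f b.+1).
exists (f 0 + 2 * k); first by rewrite expnS; case: (f 0); lia.
case=> [|b] bN; first by rewrite expn0 divn1 oddD oddM addbF; case: (f 0).
by rewrite expnS divnMA -kf//; congr (odd (_ %/ _)); case: (f 0); lia.
Qed.

Variables (I : nat) (C : 'I_I -> nat).
Implicit Types (n : state C) (i p : 'I_I) (A : demand I).

Lemma returnset_min i k p : p \in returnset i k -> i <= p.
Proof. by rewrite inE => /orP[/eqP->//|/andP[/ltnW]]. Qed.

Lemma returnset_self i k : i \in returnset i k.
Proof. by rewrite inE eqxx. Qed.

(** The digit of weight [2 ^ b] in the index tells whether component [I - b.+1] is absent, so equal
    sets have equal digits. *)
Lemma return_demand_inj i k l : k < 2 ^ (I - i.+1) -> l < 2 ^ (I - i.+1) ->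
  return_demand i k = return_demand i l -> k = l.
Proof.
move=> kN lN /(congr1 val)/= /setP kl; apply: (binary_digits_inj kN lN) => b bN.
have sI : I - b.+1 < I by lia.
have := kl (Ordinal sI); rewrite !inE /=.
have -> : (Ordinal sI == i) = false by rewrite -val_eqE /=; lia.
have -> : i < I - b.+1 by lia.
by have -> : I - (I - b.+1).+1 = b by [lia|]; move=> /= /negb_inj.
Qed.

(** The index has digit 1 at weight [2 ^ (I - s.+1)] exactly when [s] is not in [A]. Together with
    injectivity, this enumerates without repetition the demands whose least element is [i]. *)
Lemma return_demand_ex i A : i \in val A ->
  (forall p, p \in val A -> i <= p) ->
  exists2 k, k < 2 ^ (I - i.+1) & A = return_demand i k.
Proof.
move=> iA Ai.
pose f b := [forall s : 'I_I, (I - s.+1 == b) ==> (s \notin val A)].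
have [k kN kf] := binary_digits_ex (I - i.+1) f.
exists k => //; apply/val_inj/setP => s; rewrite /= inE.
have [->|si] := eqVneq s i; first by rewrite iA.
have := ltn_ord s => sI.
case: (ltnP i s) => [lt_is|le_si] /=; last first.
  by apply/negP => /Ai; move: si; rewrite -val_eqE /=; lia.
rewrite kf; last by lia.
apply/idP/idP => [sA|].
  by apply/negP => /forallP/(_ s); rewrite eqxx sA.
rewrite negb_forall => /existsP[t];
  rewrite negb_imply negbK => /andP[/eqP ts tA].
suff -> : s = t by [].
by apply/val_inj => /=; have := ltn_ord t; lia.
Qed.

(** The sets A^i_k are pairwise distinct and all contain [i], so the left side is a partial sum of
    the load. *)
Lemma cumul_load n i : cumul n i (2 ^ (I - i.+1)) <= load (val n) i.
Proof.
rewrite /cumul big_mkord.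
pose h (k : 'I_(2 ^ (I - i.+1))) := return_demand i k.
have h_inj : injective h.
  by move=> k l /return_demand_inj kl; apply/val_inj/kl.
rewrite -(big_imset (fun A => val n A)) /=; last first.
  by move=> k l _ _; apply: h_inj.
rewrite /load [leqRHS](bigID [in [set h k | k in 'I_(2 ^ (I - i.+1))]])/=.
rewrite [leqLHS](eq_bigl (fun A => (i \in val A) &&
  (A \in [set h k | k in 'I_(2 ^ (I - i.+1))]))) ?leq_addr// => A.
rewrite andbC; case: imsetP => //= -[k _ ->].
by rewrite /h /return_demand SubK returnset_self.
Qed.

Lemma load_arrive n A p :
  load (val (g n (inl A))) p =
  load (val n) p + ((p \in val A) && (psi n p < C p)).
Proof.
rewrite /= /load.
under eq_bigr do rewrite ffunE.
by rewrite big_split/= -/(load (unit_vec _) p) load_unit_vec inE.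
Qed.

Lemma load_service_le n i (j : 'I_(C i)) p :
  load (val (g n (service j))) p <= load (val n) p.
Proof.
rewrite /= /depart; case: ifP => // _.
by apply: leq_sum => B _; rewrite ffunE leq_subr.
Qed.

(** A service of [i] removes at most one demand, and the least element of that demand is [i]. Only
    components from [i] on can lose a unit, and each loses at most one. *)
Lemma load_service_ge n i (j : 'I_(C i)) p :
  load (val n) p <= load (val (g n (service j))) p + (i <= p).
Proof.
rewrite /= /depart; case: ifP => _; first exact: leq_addr.
set k := return_index n i j.
apply: (@leq_trans (load (val n) p - (p \in returnset i k) + (i <= p))).
  by have [/returnset_min->|_] := boolP (p \in _);
    rewrite ?subn0 ?leq_addr //= addnC -leq_subLR.
rewrite leq_add2r leq_subLR -load_unit_vec /load -big_split /=.
by apply: leq_sum => B _; rewrite [X in _ <= _ + X]ffunE -leq_subLR.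
Qed.

Lemma service_idle n i (j : 'I_(C i)) :
  load (val n) i <= j -> g n (service j) = n.
Proof.
move=> nj; apply: val_inj => /=; rewrite /depart ltnS.
by rewrite (leq_trans (cumul_load n i) nj).
Qed.

(** A demand present in [n] and containing [i] has no element below [i], as those components are
    empty. It is therefore some A^i_k, and the service of rank 1 finds a unit to return. *)
Lemma load_service_first n i (j : 'I_(C i)) : j = 0 :> nat ->
  (forall l : 'I_I, l < i -> load (val n) l = 0) -> 0 < load (val n) i ->
  load (val (g n (service j))) i < load (val n) i.
Proof.
move=> j0 n0 ni.
have [k kN nk] : exists2 k, k < 2 ^ (I - i.+1) & 0 < val n (return_demand i k).
  have : exists A : demand I, (i \in val A) && (0 < val n A).
    apply/existsP; rewrite -[X in is_true X]negbK negb_exists.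
    apply/negP => /forallP nA; move: ni; rewrite /load big1// => A iA.
    by have := nA A; rewrite iA -eqn0Ngt => /eqP.
  case=> A /andP[iA nA].
  have [|k kN AE] := @return_demand_ex i A iA; last by exists k; rewrite -?AE.
  move=> p pA; rewrite leqNgt; apply/negP => /n0/eqP.
  by rewrite /load sum_nat_eq0 => /forall_inP/(_ A pA)/eqP nA0;
    rewrite nA0 in nA.
have cumulS l : cumul n i l.+1 = cumul n i l + val n (return_demand i l).
  by rewrite /cumul big_nat_recr.
have cumul_mono l l' : l <= l' -> cumul n i l <= cumul n i l'.
  by move=> /subnKC<-; elim: (l' - l) => [|e]; rewrite ?addn0// addnS cumulS;
    lia.
rewrite /= /depart j0 ifN; last first.
  by have := cumul_mono _ _ kN; rewrite cumulS; lia.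
set r := return_index _ _ _.
(* The truncated subtraction in [depart] lowers the load only if the selected demand is present. To
   see that it is, [find] must succeed, and it does at the least [l] where [cumul] becomes
   positive. *)
have nr : 0 < val n (return_demand i r).
  suff : cumul n i r < 1 <= cumul n i r.+1 by rewrite cumulS; lia.
  have rE : r = find (fun k => cumul n i k < 1 <= cumul n i k.+1)
    (iota 0 (2 ^ (I - i.+1))) by [].
  have hasr : has (fun k => cumul n i k < 1 <= cumul n i k.+1)
      (iota 0 (2 ^ (I - i.+1))).
    have ex : exists l, 0 < cumul n i l.+1 by exists k; rewrite cumulS; lia.
    have lk : ex_minn ex <= k.
      by case: ex_minnP => l _; apply; rewrite cumulS; lia.
    apply/hasP; exists (ex_minn ex); first by rewrite mem_iota; lia.
    case: ex_minnP => -[|l] nl lmin; first by rewrite {1}/cumul big_geq.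
    rewrite nl andbT ltnNge; apply/negP => /lmin; lia.
  have rN : r < 2 ^ (I - i.+1) by move: hasr; rewrite has_find size_iota.
  by have := nth_find 0 hasr; rewrite -rE nth_iota.
rewrite /load (bigD1 (return_demand i r)) ?SubK ?returnset_self//=.
rewrite [ltnRHS](bigD1 (return_demand i r)) ?SubK ?returnset_self//=.
rewrite !ffunE SubK eqxx -addSn; apply: leq_add; first by rewrite subn1 prednK.
by apply: leq_sum => B _; rewrite ffunE leq_subr.
Qed.

End Dynamics.

(** * Effect of a single event on the endpoints of the envelope *)

Section Envelopes.
Local Open Scope nat_scope.

Variables (I : nat) (C : 'I_I -> nat).
Implicit Types (n : state C) (i p : 'I_I) (A : demand I).
Implicit Types (mM : xspace C * xspace C) (e : event C).

Lemma xspace_leP (x y : xspace C) :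
  reflect (forall i, x i <= y i) (x <= y)%O.
Proof. exact: forallP. Qed.

Lemma psiE n i : psi n i = load (val n) i :> nat.
Proof. by rewrite ffunE. Qed.

(** The bound [z <= C p] covers the empty meet, whose value is [\top]. *)
Lemma envelope_ge mM e p z : z <= C p ->
  (forall n, (mM.1 <= psi n <= mM.2)%O -> z <= load (val (g n e)) p) ->
  z <= (envelope mM e).1 p.
Proof.
move=> zC zg; rewrite /envelope /=.
have topz : z <= (\top%O : xspace C) p by rewrite ffunE.
have meetz (x y : xspace C) : z <= x p -> z <= y p -> z <= (x `&` y)%O p.
  by move=> zx zy; rewrite ffunE; case: leP.
apply: (big_ind (fun y : xspace C => z <= y p)) => // x xmM.
apply: (big_ind (fun y : xspace C => z <= y p)) => // y.
rewrite inE => -[n nx <-]; rewrite psiE; apply: zg.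
by rewrite nx.
Qed.

Lemma envelope_le mM e p z :
  (forall n, (mM.1 <= psi n <= mM.2)%O -> load (val (g n e)) p <= z) ->
  (envelope mM e).2 p <= z.
Proof.
move=> zg; rewrite /envelope /=.
have botz : (\bot%O : xspace C) p <= z by rewrite ffunE.
have joinz (x y : xspace C) : x p <= z -> y p <= z -> (x `|` y)%O p <= z.
  by move=> zx zy; rewrite ffunE; case: leP.
apply: (big_ind (fun y : xspace C => y p <= z)) => // x xmM.
apply: (big_ind (fun y : xspace C => y p <= z)) => // y.
rewrite inE => -[n nx <-]; rewrite psiE; apply: zg.
by rewrite nx.
Qed.

Lemma envelope_mem mM e n : (mM.1 <= psi n <= mM.2)%O ->
  ((envelope mM e).1 <= psi (g n e) <= (envelope mM e).2)%O.
Proof.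
move=> nmM; rewrite /envelope /=.
have ng : psi (g n e) \in successors (psi n) e by rewrite inE; exists n.
apply/andP; split.
  by apply: (meets_max (j := psi n)) => //;
    exact: (meets_max (j := psi (g n e))).
by apply: (joins_min (j := psi n)) => //; exact: (joins_min (j := psi (g n e))).
Qed.

(** The interval never becomes empty: it always contains the image of the trajectory started from
    the empty system. *)
Lemma envelope_word_le (w : seq (event C)) :
  ((envelope_word (\bot%O, \top%O) w).1 <=
   (envelope_word (\bot%O, \top%O) w).2)%O.
Proof.
suff [n /andP[]] : exists n, ((envelope_word (\bot%O, \top%O) w).1 <= psi n
    <= (envelope_word (\bot%O, \top%O) w).2)%O by exact: le_trans.
elim/last_ind: w => [|w e [n nw]]; last first.
  by exists (g n e); rewrite /envelope_word foldl_rcons; exact: envelope_mem.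
have n0 : feasible C [ffun=> 0].
  by apply/forallP => i; rewrite /load big1// => A _; rewrite ffunE.
by exists (Sub [ffun=> 0] n0); rewrite le0x lex1.
Qed.

Lemma lower_arrival mM A p :
  minn (mM.1 p + (p \in val A)) (C p) <= (envelope mM (arrival C A)).1 p.
Proof.
apply: envelope_ge => [|n /andP[/xspace_leP/(_ p) mn _]]; first exact: geq_minr.
rewrite load_arrive psiE; rewrite psiE in mn.
by have := load_lt n p; case: (p \in _); case: ltnP; rewrite ?addn0 ?addn1; lia.
Qed.

Lemma upper_arrival mM A p :
  (envelope mM (arrival C A)).2 p <= mM.2 p + (p \in val A).
Proof.
apply: envelope_le => n /andP[_ /xspace_leP/(_ p)]; rewrite load_arrive psiE.
by case: (p \in _); case: ltnP; rewrite ?addn0 ?addn1; lia.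
Qed.

(** Take [i = p] and [mM.1 p <= j]. A state with load at most [j] is left unchanged, and one with a
    larger load stays at or above [mM.1 p] after losing one unit. *)
Lemma lower_service mM i (j : 'I_(C i)) p :
  mM.1 p <=
  (envelope mM (service j)).1 p + ((i < p) || (i == p) && (j < mM.1 p)).
Proof.
rewrite addnC -leq_subLR.
apply: envelope_ge => [|n /andP[/xspace_leP/(_ p) mn _]].
  by have := ltn_ord (mM.1 p); lia.
have idle : i = p -> load (val n) p <= j ->
    load (val (g n (service j))) p = load (val n) p.
  by move=> ip; rewrite -ip => nj; rewrite (service_idle nj).
rewrite psiE in mn; move: mn idle (load_service_ge n j p).
move: (load (val n) p) (load (val (g n (service j))) p) => L L' mL idle.
case: ltngtP => [ip|ip|/val_inj ip] /=; first by rewrite addn1 subn1; lia.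
  have -> : (i == p) = false by rewrite -val_eqE /=; lia.
  by rewrite addn0 subn0; lia.
have -> : (i == p) = true by rewrite ip eqxx.
rewrite addn1 /=; case: ltnP => mj; rewrite ?subn1 ?subn0; first lia.
by have [/(idle ip)->|] := leqP L j; lia.
Qed.

Lemma upper_service mM i (j : 'I_(C i)) p :
  (envelope mM (service j)).2 p <= mM.2 p.
Proof.
apply: envelope_le => n /andP[_ /xspace_leP/(_ p)]; rewrite psiE.
exact/leq_trans/load_service_le.
Qed.

(** A state below [mM.2] has no load before [i]. If its load at [i] is positive, the service lowers
    it; if it is zero, it is already below [mM.2 i]. *)
Lemma upper_service_first mM i (j : 'I_(C i)) : j = 0 :> nat ->
  (forall l : 'I_I, l < i -> mM.2 l = 0 :> nat) -> 0 < mM.2 i ->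
  (envelope mM (service j)).2 i < mM.2 i.
Proof.
move=> j0 M0 Mi; rewrite -[ltnRHS](prednK Mi) ltnS.
apply: envelope_le => n /andP[_ /xspace_leP nM].
have := nM i; rewrite psiE => nMi.
have [n0|n_gt0] := posnP (load (val n) i).
  by have := load_service_le n j i; lia.
have n0 (l : 'I_I) : l < i -> load (val n) l = 0.
  by move=> /M0 Ml; have := nM l; rewrite psiE; lia.
by have := load_service_first j0 n0 n_gt0; lia.
Qed.

End Envelopes.

(** * Expectations over finite words, and Foster's criterion *)

Section WordMean.

Variables (R : realType) (E : finType) (q : E -> R).
Hypothesis q_ge0 : forall e, 0 <= q e.

(* Expectation of [f] on words of [t] independent letters of law [q]. *)
Fixpoint word_mean (t : nat) (f : seq E -> R) : R :=
  if t is t'.+1 then \sum_e q e * word_mean t' (fun w => f (e :: w))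
  else f [::].

Lemma word_mean_le t f f' : (forall w, size w = t -> f w <= f' w) ->
  word_mean t f <= word_mean t f'.
Proof.
elim: t f f' => [|t IHt] f f' ff' /=; first exact: ff'.
apply: ler_sum => e _; apply: ler_wpM2l => //; apply: IHt => w wt.
by apply: ff'; rewrite /= wt.
Qed.

Lemma word_meanD t f f' :
  word_mean t (fun w => f w + f' w) = word_mean t f + word_mean t f'.
Proof.
elim: t f f' => [|t IHt] f f' //=.
by rewrite -big_split; apply: eq_bigr => e _; rewrite IHt mulrDr.
Qed.

Lemma word_mean0 t : word_mean t (fun=> 0) = 0.
Proof.
by elim: t => //= t IHt; rewrite big1// => e _; rewrite IHt mulr0.
Qed.

Lemma word_mean_sum (J : Type) (r : seq J) (Q : pred J) t
    (F : J -> seq E -> R) :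
  word_mean t (fun w => \sum_(k <- r | Q k) F k w) =
  \sum_(k <- r | Q k) word_mean t (F k).
Proof.
elim: r => [|k r IHr].
  rewrite big_nil -[RHS](word_mean0 t); congr word_mean.
  by apply/funext => w; rewrite big_nil.
rewrite big_cons -IHr; case: ifP => Qk.
  rewrite -word_meanD; congr word_mean.
  by apply/funext => w; rewrite big_cons Qk.
by congr word_mean; apply/funext => w; rewrite big_cons Qk.
Qed.

(* Foster's criterion: a nonnegative potential that loses at least [eps] in
   mean at each step outside the target bounds the expected hitting time. *)
Lemma hitting_time_bound (S : Type) (step : S -> E -> S) (target : pred S)
    (V : S -> R) (eps : R) :
  (forall s, 0 <= V s) -> 0 < eps ->
  (forall s, ~~ target s -> \sum_e q e * V (step s e) <= V s - eps) ->
  forall N s, \sum_(0 <= t < N)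
    word_mean t (fun w => (all (predC target) (s :: scanl step s w))%:R)
  <= V s / eps.
Proof.
move=> V_ge0 eps_gt0 drift; elim=> [|N IHN] s.
  by rewrite big_geq// divr_ge0// ltW.
have [sT|sT] := boolP (target s).
  rewrite big1_seq ?divr_ge0 ?(ltW eps_gt0)// => t _.
  by rewrite -[RHS](word_mean0 t); congr word_mean; apply/funext => w /=;
    rewrite sT.
(* Outside the target, time 0 contributes 1. The later times are bounded by the induction hypothesis
   at the state reached after one letter, and the drift absorbs the 1. *)
rewrite big_nat_recl// [word_mean 0 _]/= sT /=.
rewrite exchange_big/=
  (@le_trans _ _ (1 + \sum_e q e * (V (step s e) / eps)))//.
  rewrite lerD2l; apply: ler_sum => e _.
  rewrite -mulr_sumr; apply: ler_wpM2l => //; apply: le_trans (IHN (step s e)).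
  by apply: ler_sum => t _; apply: word_mean_le => w _; rewrite /= sT.
under eq_bigr do rewrite mulrA.
rewrite -mulr_suml -lerBrDl ler_pdivrMr// mulrBl divfK ?gt_eqF// mul1r.
exact: drift.
Qed.

End WordMean.

(** * Law of the backward word *)

Section IidWords.
Local Open Scope classical_set_scope.

Variables (d : measure_display) (T : measurableType d) (R : realType).
Variables (P : probability T R) (E : finType) (q : E -> R) (a : nat -> T -> E).
Hypothesis a_iid : iid_seq P q a.

Definition word_event (t : nat) (B : pred (seq E)) : set T :=
  [set w | B (past_word (fun k => a k w) t 0)].

(** Going one step further into the past adds a letter at the head, which matches the recursion of
    [word_mean] on the first letter. *)
Lemma past_wordS (b : nat -> E) t :
  past_word b t.+1 0 = b t :: past_word b t 0.
Proof. by rewrite /past_word !subn0 -addn1 iotaD add0n rev_cat. Qed.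

Lemma word_eventS t B :
  word_event t.+1 B =
  \bigcup_(e in [set: E])
    (a t @^-1` [set e] `&` word_event t (fun w => B (e :: w))).
Proof.
apply/seteqP; split => w /=.
  by rewrite /word_event/= past_wordS => Bw; exists (a t w).
by move=> [e _] [/= <-]; rewrite /word_event/= past_wordS.
Qed.

Lemma word_event0 B : word_event 0 B = if B [::] then setT else set0.
Proof. by apply/seteqP; split => w; rewrite /word_event/=; case: (B [::]). Qed.

Lemma measurable_word_event t B : measurable (word_event t B).
Proof.
elim: t B => [|t IHt] B.
  by rewrite word_event0; case: (B [::]).
rewrite word_eventS; apply: fin_bigcup_measurable => // e _.
by apply: measurableI => //; exact: (iid_measurable a_iid).
Qed.

Definition cylinder (J : seq nat) (c : nat -> E) : set T :=
  \bigcap_(k in [set` J]) (a k @^-1` [set c k]).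

Lemma measurable_cylinder J c : measurable (cylinder J c).
Proof.
by apply: fin_bigcap_measurable => // k _; exact: (iid_measurable a_iid).
Qed.

Lemma measure_cylinder J c : uniq J ->
  P (cylinder J c) = (\prod_(k <- J) q (c k))%:E.
Proof.
move=> Ju; rewrite /cylinder (iid_independent a_iid (fun k => [set c k]))//.
by rewrite -prodEFin; apply: eq_bigr => k _; rewrite (iid_law a_iid).
Qed.

(* Fixing letters older than the word makes the induction on t go through. *)
Lemma measure_cylinder_word t J c B :
  uniq J -> (forall k, k \in J -> (t <= k)%N) ->
  P (cylinder J c `&` word_event t B) =
  ((\prod_(k <- J) q (c k)) * word_mean q t (fun w => (B w)%:R))%:E.
Proof.
elim: t J c B => [|t IHt] J c B Ju tJ.
  rewrite word_event0 /=; case: (B [::]); last by rewrite setI0 measure0 mulr0.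
  by rewrite setIT measure_cylinder// mulr1.
have tJ' : t \notin J by apply/negP => /tJ; rewrite ltnn.
(* The letter at [t] joins the prescribed ones with value [e]; since [t] is not in [J], the earlier
   prescriptions are kept. *)
pose c' e k := if k == t then e else c k.
have c'J e k : k \in J -> c' e k = c k.
  by move=> /tJ tk; rewrite /c' gtn_eqF.
rewrite word_eventS setI_bigcupr measure_fin_bigcup//; first last.
- move=> e _; apply: measurableI; first exact: measurable_cylinder.
  by apply: measurableI;
    [exact: (iid_measurable a_iid)|exact: measurable_word_event].
- by move=> e e' _ _ [w [[_ [/= <- _]] [_ [/= <- _]]]].
- exact: finite_finset.
rewrite fsbig_finite/=; last exact: finite_finset.
rewrite (perm_big (index_enum E))/=; last first.
  apply: uniq_perm; [exact: finmap.fset_uniq|exact: index_enum_uniq|move=> e].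
  rewrite mem_index_enum in_fset_set; last exact: finite_finset.
  exact: mem_set.
rewrite mulr_sumr -sumEFin; apply: eq_bigr => e _.
have -> :
  cylinder J c `&` (a t @^-1` [set e] `&` word_event t (fun w => B (e :: w))) =
    cylinder (t :: J) (c' e) `&` word_event t (fun w => B (e :: w)).
  rewrite setIA; congr (_ `&` _); apply/seteqP; split => w.
    move=> [cw /= <-] k /=; rewrite inE => /orP[/eqP->|kJ];
      first by rewrite /c' eqxx.
    by rewrite c'J//; exact: cw.
  move=> cw; split; last first.
    by have := cw t; rewrite /= mem_head /c' eqxx => /(_ isT).
  move=> k /= kJ; have := cw k; rewrite /= inE kJ orbT => /(_ isT).
  by rewrite c'J.
rewrite IHt/= ?tJ' //.
  rewrite big_cons {1}/c' eqxx.
  rewrite (eq_big_seq (fun k => q (c k))); last by move=> k kJ; rewrite c'J.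
  by congr (_%:E); ring.
by move=> k; rewrite inE => /orP[/eqP->//|/tJ/ltnW].
Qed.

Lemma measure_word_event t B :
  P (word_event t B) = (word_mean q t (fun w => (B w)%:R))%:E.
Proof.
(* A sample point supplies a function [nat -> E] to serve as [c] for the empty cylinder; one exists
   because [P] has mass 1. *)
have /set0P[w _] : [set: T] != set0.
  apply/eqP => T0; have := probability_setT P.
  by rewrite T0 measure0 => /eqP; rewrite eq_sym onee_eq0.
have := @measure_cylinder_word t [::] (a ^~ w) B isT.
rewrite big_nil mul1r => <- //.
rewrite (_ : cylinder _ _ = setT) ?setTI//.
by apply/seteqP; split.
Qed.

End IidWords.

(** * From the coupling time to a series of word expectations *)

Section CouplingTime.
Local Open Scope classical_set_scope.

Variables (I : nat) (C : 'I_I -> nat).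
Hypothesis I_gt0 : (0 < I)%N.

Definition coupled_word (t : nat) (w : seq (event C)) : bool :=
  [forall i : 'I_I, [exists s : 'I_t,
    let H := envelope_word (\bot%O, \top%O) (take (t - s) w) in
    H.1 i == H.2 i]].

(** Omitting the [s] most recent events keeps the first [t - s] letters, so all envelopes starting
    at the same past time lie along one forward path. *)
Lemma all_coupledE (b : nat -> event C) t :
  all_coupled b t = coupled_word t (past_word b t 0).
Proof.
apply: eq_forallb => i; apply: eq_existsb => s.
suff -> : past_word b t s = take (t - s) (past_word b t 0) by [].
have st := ltn_ord s; rewrite /past_word -map_take subn0; congr map.
rewrite take_rev size_iota drop_iota; congr (rev (iota _ _)); lia.
Qed.

Lemma not_all_coupled0 (b : nat -> event C) : ~~ all_coupled b 0.
Proof.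
rewrite negb_forall; apply/existsP; exists (Ordinal I_gt0).
by rewrite negb_exists; apply/forallP => -[].
Qed.

(** This is the tail-sum formula. Requiring failure at every time up to [t] makes the indicator that
    of [t] being smaller than the coupling time, with no appeal to monotonicity of [all_coupled]. If
    coupling never occurs, all terms are 1 and the series diverges. *)
Lemma tau_alg_series (R : realType) (b : nat -> event C) :
  tau_alg R b =
  (\sum_(0 <= t <oo) ([forall s : 'I_t.+1, ~~ all_coupled b s]%:R)%:E)%E.
Proof.
rewrite /tau_alg; case: pselect => [ex|nex].
  case: ex_minnP => N /andP[N_gt0 bN] Nmin.
  have tE t : [forall s : 'I_t.+1, ~~ all_coupled b s] = (t < N)%N.
    apply/forallP/idP => [bt|tN s].
      rewrite ltnNge; apply/negP => Nt.
      by have := bt (Ordinal (Nt : (N < t.+1)%N)); rewrite /= bN.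
    have [->|s_gt0] := posnP s; first exact: not_all_coupled0.
    by apply/negP => bs; have := Nmin s; rewrite s_gt0 bs => /(_ isT);
      have := ltn_ord s; lia.
  under eq_eseriesr do rewrite tE.
  rewrite (nneseries_split 0 N); last by move=> k _; rewrite lee_fin.
  rewrite add0n eseries0 ?adde0; last by move=> k Nk _ /=; rewrite ltnNge Nk.
  rewrite sumEFin; congr (_%:E).
  rewrite (eq_big_nat _ _ (F2 := fun=> 1)); last by move=> k /andP[_ ->].
  by rewrite big_const_nat subn0 iter_addr_0.
have tE t : [forall s : 'I_t.+1, ~~ all_coupled b s].
  apply/forallP => s; have [->|s_gt0] := posnP s; first exact: not_all_coupled0.
  by apply/negP => bs; apply: nex; exists s; rewrite s_gt0.
apply/esym/eq_infty => r; under eq_eseriesr do rewrite tE.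
have [n rn] : exists n : nat, r <= n%:R.
  by exists (Num.truncn `|r|).+1;
    rewrite (le_trans (ler_norm r))// ltW// truncnS_gt.
apply: (@le_trans _ _ (\sum_(0 <= t < n) 1)%E); last exact: nneseries_lim_ge.
by rewrite sumEFin lee_fin big_const_nat subn0 iter_addr_0.
Qed.

(** The tail series is integrated term by term, and each tail event [D t] is enlarged to the event
    of no coupling at time [t] alone, which depends on a single word. *)
Lemma expected_tau_alg_le (d : measure_display) (T : measurableType d)
    (R : realType) (P : probability T R) (q : event C -> R)
    (a : nat -> T -> event C) (a_iid : iid_seq P q a) (b : R) :
  (forall N, \sum_(0 <= t < N)
     word_mean q t (fun w => (~~ coupled_word t w)%:R) <= b) ->
  (\int[P]_w tau_alg R (fun t => a t w) <= b%:E)%E.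
Proof.
move=> sum_le.
pose D t := \bigcap_(s in `I_t.+1) word_event a s (predC (coupled_word s)).
have mD t : measurable (D t).
  by apply: bigcap_measurable => [|s _];
    [exists 0%N|exact: (measurable_word_event a_iid)].
have DE w t : \1_(D t) w =
    [forall s : 'I_t.+1, ~~ all_coupled (fun t => a t w) s]%:R :> R.
  rewrite indicE; congr (nat_of_bool _)%:R; apply/idP/forallP.
    by rewrite inE => Dw s; have := Dw s (ltn_ord s);
      rewrite /word_event/= all_coupledE.
  by move=> h; rewrite inE => s /= st; have := h (Ordinal st);
    rewrite /= all_coupledE.
have -> : (fun w => tau_alg R (fun t => a t w)) =
    (fun w => \sum_(0 <= t <oo) (\1_(D t) w)%:E)%E.
  by apply: funext => w; rewrite tau_alg_series; apply: eq_eseriesr => t _;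
    rewrite DE.
rewrite integral_nneseries//; last first.
  by move=> t; apply/measurable_realfun.measurable_EFinP;
    exact: measurable_realfun.measurable_indic.
apply: lime_le; first by apply: is_cvg_nneseries => t _ _; exact: integral_ge0.
apply: nearW => N; apply: (@le_trans _ _ (\sum_(0 <= t < N)
     word_mean q t (fun w => (~~ coupled_word t w)%:R))%:E);
       last by rewrite lee_fin.
rewrite -sumEFin; apply: lee_sum => t _.
rewrite integral_indic// setIT.
rewrite -(measure_word_event a_iid t (predC (coupled_word t))).
apply: le_measure; rewrite ?inE//; first exact: (measurable_word_event a_iid).
by apply: bigcap_inf => /=.
Qed.

End CouplingTime.

(** * Mean drift of the two potentials *)

Section Drift.

Variables (R : realType) (I : nat) (C : 'I_I -> nat).
Variables (mu : R) (lambda : demand I -> R).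
Hypotheses (I_gt0 : (0 < I)%N) (C_gt0 : forall i, (0 < C i)%N).
Hypotheses (mu_gt0 : 0 < mu) (lambda_ge0 : forall A, 0 <= lambda A).

Local Notation L := (Lambda C lambda mu).
Local Notation q := (@nu R I C lambda mu).

Lemma Lambda_gt0 : 0 < L.
Proof.
apply: ltr_wpDl; first exact: sumr_ge0.
apply: mulr_gt0 => //; rewrite ltr0n (bigD1 (Ordinal I_gt0)) //=.
by rewrite ltn_addr.
Qed.

Lemma nu_ge0 e : 0 <= q e.
Proof.
by case: e => [A|x]; rewrite /nu divr_ge0 ?(ltW Lambda_gt0)// ltW.
Qed.

(** The constant [v] keeps its full weight because [nu] has total mass 1; [alpha] and [beta] bound
    the increments caused by arrivals and services. *)
Lemma nu_mean_le (f : event C -> R) v (alpha : demand I -> R)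
    (beta : forall i, 'I_(C i) -> R) :
  (forall A, f (arrival C A) <= v + alpha A) ->
  (forall i (j : 'I_(C i)), f (service j) <= v + beta i j) ->
  \sum_e q e * f e <=
    v + (\sum_A lambda A * alpha A + mu * \sum_i \sum_(j < C i) beta i j) / L.
Proof.
move=> f_arr f_serv; have L_gt0 := Lambda_gt0.
rewrite big_sumType /=.
have serv_le : \sum_(x : {i : 'I_I & 'I_(C i)}) q (inr x) * f (inr x) <=
    \sum_i \sum_(j < C i) mu / L * (v + beta i j).
  rewrite (sig_big_dep _ _ (fun i (j : 'I_(C i)) => mu / L * (v + beta i j))).
  apply: ler_sum => -[i j] _ /=; apply: ler_wpM2l; last exact: f_serv.
  by rewrite divr_ge0 ?(ltW L_gt0)// ltW.
have arr_le :
  \sum_A q (inl A) * f (inl A) <= \sum_A lambda A / L * (v + alpha A).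
  apply: ler_sum => A _; apply: ler_wpM2l; last exact: f_arr.
  by rewrite divr_ge0 ?(ltW L_gt0).
apply: le_trans (lerD arr_le serv_le) _.
rewrite le_eqVlt; apply/orP; left; apply/eqP.
have -> : \sum_A lambda A / L * (v + alpha A) =
    ((\sum_A lambda A) * v + \sum_A lambda A * alpha A) / L.
  rewrite mulr_suml -big_split/= mulr_suml; apply: eq_bigr => A _.
  by rewrite -mulrDr mulrAC.
have -> : \sum_i \sum_(j < C i) mu / L * (v + beta i j) =
    mu / L * ((\sum_i C i)%:R * v + \sum_i \sum_(j < C i) beta i j).
  rewrite natr_sum mulr_suml -big_split/= mulr_sumr; apply: eq_bigr => i _.
  by rewrite -mulr_sumr big_split/= sumr_const card_ord mulr_natl.
have LE : L = \sum_A lambda A + mu * (\sum_i C i)%:R by [].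
have {LE} -> : \sum_A lambda A = L - mu * (\sum_i C i)%:R by rewrite LE addrK.
field; exact: lt0r_neq0.
Qed.

(* While m_p < C_p, at least one of the events r^p_1, ..., r^p_{C_p} cannot
   lower m_p: this is the "- 1" in delta_p. *)
Lemma lower_drift (p : 'I_I) (s : xspace C * xspace C) : (s.1 p < C p)%N ->
  \sum_e q e * ((C p)%:R - ((envelope s e).1 p)%:R) <=
    (C p)%:R - (s.1 p)%:R - delta C lambda mu p / L.
Proof.
move=> sC; set v := (C p)%:R - (s.1 p)%:R.
(* These are the services that may lower the bound on component [p]. *)
pose beta i (j : 'I_(C i)) := ((i < p)%N || (i == p) && (j < s.1 p)%N).
have arr A : (C p)%:R - ((envelope s (arrival C A)).1 p)%:R <=
    v + - (p \in val A)%:R.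
  have : (s.1 p + (p \in val A) <= (envelope s (arrival C A)).1 p)%N.
    apply: leq_trans (lower_arrival s A p).
    by rewrite leq_min leqnn; case: (p \in _); rewrite ?addn0 ?addn1// ltnW.
  by rewrite -(ler_nat R) natrD /v; lra.
have serv i (j : 'I_(C i)) : (C p)%:R - ((envelope s (service j)).1 p)%:R <=
    v + (beta i j)%:R.
  have := lower_service s j p.
  by rewrite -/(beta i j) -(ler_nat R) natrD /v; lra.
apply: le_trans (nu_mean_le arr serv) _.
rewrite lerD2l -mulNr ler_pM2r ?invr_gt0 ?Lambda_gt0//.
have -> : \sum_A lambda A * - (p \in val A)%:R = - rate_of lambda p.
  rewrite /rate_of -sumrN [RHS]big_mkcond; apply: eq_bigr => A _.
  by case: (p \in _); rewrite /= ?mulrN1 ?oppr0 ?mulr0.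
under eq_bigr do rewrite -natr_sum.
rewrite -natr_sum /delta opprB addrC lerD2r ler_pM2l// lerBrDr natr1 ler_nat.
(* The extra 1 is charged to component [p], where the service of index [s.1 p] exists by [sC] and is
   not counted by [beta]. *)
have -> : (\sum_i \sum_(j < C i) beta i j).+1 =
    (\sum_i (\sum_(j < C i) beta i j + (i == p)))%N.
  rewrite big_split/= -big_mkcond big_pred1_eq addn1.
  by rewrite (bigD1 p)//= eqxx big1 ?addn0 ?addn1// => i /negbTE ->.
rewrite [leqRHS]big_mkcond/=; apply: leq_sum => i _.
have [->|ip] := eqVneq i p.
  rewrite leqnn (bigD1 (Ordinal sC))//= /beta ltnn ltnn andbF add0n addn1.
  rewrite -[ltnRHS]card_ord -sum1_card [ltnRHS](bigD1 (Ordinal sC))//=.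
  rewrite add1n ltnS.
  by apply: leq_sum => j _; exact: leq_b1.
rewrite addn0; case: (leqP i p) => [_|pi].
  by rewrite -[leqRHS]card_ord -sum1_card; apply: leq_sum => j _; exact: leq_b1.
by rewrite big1// => j _; rewrite /beta (negbTE ip) ltnNge (ltnW pi).
Qed.

Variables I0 IC : {set 'I_I}.
Hypothesis I0_IC : (I0 :|: IC)%SET = [set: 'I_I]%SET.
Hypothesis I0_le_IC : forall i j, i \in I0 -> j \in IC -> (i <= j)%N.

(* If i0 is the first component of I0 with M_i0 > 0, every unit held by i0 in a
   state below M is returned first by i0, so r^{i0}_1 surely lowers M_i0. *)
Lemma upper_drift (s : xspace C * xspace C) :
  ~~ [forall i in I0, s.2 i == 0 :> nat] ->
  \sum_e q e * (\sum_(i in I0) (envelope s e).2 i)%:R <=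
    (\sum_(i in I0) s.2 i)%:R - (mu - \sum_(i in I0) rate_of lambda i) / L.
Proof.
rewrite negb_forall_in => /exists_inP[k kI0 sk].
pose K i := (i \in I0) && (s.2 i != 0 :> nat).
have Kk : K k by rewrite /K kI0.
case: (arg_minnP (fun i : 'I_I => i : nat) Kk) => i0 /andP[i0I0 si0] i0min.
(* By [I0_le_IC], a component before [i0] cannot lie in [IC], so it lies in [I0] and vanishes by
   minimality of [i0]. *)
have s0 (l : 'I_I) : (l < i0)%N -> s.2 l = 0 :> nat.
  move=> li0; apply/eqP/negPn/negP => sl.
  have : l \in (I0 :|: IC)%SET by rewrite I0_IC inE.
  rewrite inE => /orP[lI0|/(I0_le_IC i0I0)].
    by have := i0min l; rewrite /K lI0 sl => /(_ isT); rewrite leqNgt li0.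
  by rewrite leqNgt li0.
set v := (\sum_(i in I0) s.2 i)%:R.
pose beta i (j : 'I_(C i)) := (i == i0) && (j == 0 :> nat).
have arr A : (\sum_(i in I0) (envelope s (arrival C A)).2 i)%:R <=
    v + (\sum_(i in I0) (i \in val A))%:R.
  rewrite /v -natrD -big_split ler_nat; apply: leq_sum => i _.
  exact: upper_arrival.
have serv i (j : 'I_(C i)) : (\sum_(i in I0) (envelope s (service j)).2 i)%:R <=
    v + - (beta i j)%:R.
  rewrite lerBrDr -natrD ler_nat (bigD1 i0)//= [leqRHS](bigD1 i0)//= addnAC.
  apply: leq_add; last by apply: leq_sum => l _; exact: upper_service.
  have [/andP[/eqP ii0 /eqP j0]|_] := boolP (beta i j).
    by subst i; rewrite addn1; apply: upper_service_first => //; rewrite lt0n.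
  by rewrite addn0 upper_service.
apply: le_trans (nu_mean_le arr serv) _.
rewrite lerD2l -mulNr ler_pM2r ?invr_gt0 ?Lambda_gt0// opprB.
have -> : \sum_A lambda A * (\sum_(i in I0) (i \in val A))%:R =
    \sum_(i in I0) rate_of lambda i.
  under eq_bigr do rewrite natr_sum mulr_sumr.
  rewrite exchange_big/=; apply: eq_bigr => i _.
  rewrite /rate_of [RHS]big_mkcond; apply: eq_bigr => A _.
  by case: (i \in _); rewrite ?mulr1 ?mulr0.
rewrite lerD2l (bigD1 i0)//= [X in _ + X]big1 ?addr0; last first.
  by move=> i /negbTE ii0; rewrite big1// => j _; rewrite /beta ii0 oppr0.
rewrite (bigD1 (Ordinal (C_gt0 i0)))//= /beta !eqxx [X in _ + X]big1 ?addr0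
  ?mulrN1//.
by move=> j; rewrite -val_eqE /= => /negbTE ->; rewrite oppr0.
Qed.

(** Some component [i] is uncoupled along all nonempty prefixes. As the lower endpoint stays below
    the upper one, a vanishing upper value or a full lower value at [i] would couple it. *)
Lemma uncoupled_hitting t (w : seq (event C)) :
  size w = t -> ~~ coupled_word t w ->
  let s0 : xspace C * xspace C := (\bot%O, \top%O) in
  let path := s0 :: scanl (@envelope I C) s0 w in
  let hit0 (s : xspace C * xspace C) := [forall i in I0, s.2 i == 0 :> nat] in
  let hit p (s : xspace C * xspace C) := s.1 p == C p :> nat in
  all (predC hit0) path \/ exists2 p, p \in IC & all (predC (hit p)) path.
Proof.
move=> wt; rewrite negb_forall => /existsP[i];
  rewrite negb_exists => /forallP wi s0 path hit0 hit.
have wi' k : (0 < k <= t)%N -> (envelope_word s0 (take k w)).1 i !=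
    (envelope_word s0 (take k w)).2 i.
  move=> kt; have tk : (t - k < t)%N by clear -kt; lia.
  by have := wi (Ordinal tk); rewrite /= subKn//; case/andP: kt.
(* The initial interval corresponds to [s = t], outside the range of [s] in [coupled_word], so it is
   treated apart; there [C_gt0] excludes a hit. *)
have prefix (Q : pred (xspace C * xspace C)) : ~~ Q s0 ->
    (forall k, (0 < k <= t)%N -> ~~ Q (envelope_word s0 (take k w))) ->
    all (predC Q) (s0 :: scanl (@envelope I C) s0 w).
  move=> Q0 Qk; apply/(all_nthP s0) => -[|k]//=; rewrite size_scanl ltnS => kw.
  by rewrite nth_scanl// Qk// -wt.
have : i \in (I0 :|: IC)%SET by rewrite I0_IC inE.
rewrite inE => /orP[iI|iI]; [left|right; exists i => //].
  apply: prefix => [|k kt].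
    rewrite /hit0 negb_forall_in; apply/exists_inP; exists i => //=.
    by rewrite ffunE -lt0n; exact: C_gt0.
  apply: contra (wi' k kt) => /forall_inP/(_ i iI)/eqP Mi0.
  have /xspace_leP/(_ i) := envelope_word_le (take k w).
  by rewrite -val_eqE /= Mi0 leqn0.
apply: prefix => [|k kt].
  by rewrite /hit ffunE /= eq_sym -lt0n; exact: C_gt0.
apply: contra (wi' k kt) => /eqP mi.
have /xspace_leP/(_ i) := envelope_word_le (take k w).
rewrite -val_eqE /= -/s0 mi => CM; rewrite eqn_leq CM -ltnS; exact: ltn_ord.
Qed.

End Drift.

Theorem theorem22 (R : realType) (I : nat) (I_gt0 : (0 < I)%N)
    (C : 'I_I -> nat) (C_gt0 : forall i, (0 < C i)%N)
    (mu : R) (mu_gt0 : 0 < mu)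
    (lambda : demand I -> R) (lambda_ge0 : forall A, 0 <= lambda A)
    (d : measure_display) (T : measurableType d) (P : probability T R)
    (a : nat -> T -> event C) (a_iid : iid_seq P (nu lambda mu) a)
    (I0 IC : {set 'I_I}) (I0_IC : (I0 :|: IC)%SET = [set: 'I_I]%SET)
    (H1 : \sum_(i in I0) rate_of lambda i < mu)
    (H2 : forall p, p \in IC -> 0 < delta C lambda mu p)
    (H3 : forall i j, i \in I0 -> j \in IC -> (i <= j)%N) :
  (\int[P]_w tau_alg R (fun t => a t w) <=
    (Lambda C lambda mu / (mu - \sum_(i in I0) rate_of lambda i)
       * (\sum_(i in I0) C i)%:R
     + \sum_(p in IC) Lambda C lambda mu / delta C lambda mu p * (C p)%:R)%:E)%E.
Proof.
have L_gt0 := Lambda_gt0 I_gt0 C_gt0 mu_gt0 lambda_ge0.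
have q_ge0 := nu_ge0 I_gt0 C_gt0 mu_gt0 lambda_ge0.
set q := @nu R I C lambda mu.
pose s0 : xspace C * xspace C := (\bot%O, \top%O).
pose hit0 (s : xspace C * xspace C) := [forall i in I0, s.2 i == 0 :> nat].
pose hit p (s : xspace C * xspace C) := s.1 p == C p :> nat.
pose miss (h : pred (xspace C * xspace C)) (w : seq (event C)) : R :=
  (all (predC h) (s0 :: scanl (@envelope I C) s0 w))%:R.
apply: (expected_tau_alg_le I_gt0 a_iid) => N.
(* Union bound over the hitting times that can be late. *)
apply: (@le_trans _ _ (\sum_(0 <= t < N) (word_mean q t (miss hit0)
    + \sum_(p in IC) word_mean q t (miss (hit p))))).
  apply: ler_sum => t _; rewrite -word_mean_sum -word_meanD.
  apply: word_mean_le => // w wt; have [_|wC] := boolP (coupled_word t w).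
    by rewrite addr_ge0 ?ler0n// sumr_ge0// => p _; rewrite ler0n.
  have [m0|[p pIC mp]] := uncoupled_hitting C_gt0 I0_IC wt wC.
    by rewrite {1}/miss m0 lerDl sumr_ge0// => p _; rewrite ler0n.
  rewrite (bigD1 p)//= {2}/miss mp addrCA lerDl addr_ge0 ?ler0n//.
  by rewrite sumr_ge0// => p' _; rewrite ler0n.
rewrite big_split/= exchange_big/=; apply: lerD.
  pose V (s : xspace C * xspace C) : R := (\sum_(i in I0) s.2 i)%:R.
  apply: le_trans (@hitting_time_bound _ _ q q_ge0 _ (@envelope I C) hit0 V
    ((mu - \sum_(i in I0) rate_of lambda i) / Lambda C lambda mu) _ _ _ N s0) _.
  - by move=> s; rewrite ler0n.
  - by rewrite divr_gt0// subr_gt0.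
  - by move=> s; exact: (upper_drift I_gt0 C_gt0 mu_gt0 lambda_ge0 I0_IC H3).
  (* At the top element the potential is at most the total capacity of [I0]. *)
  rewrite invf_div mulrC; apply: ler_wpM2l.
    by rewrite divr_ge0 ?subr_ge0 ?(ltW L_gt0) ?(ltW H1).
  by rewrite ler_nat; apply: leq_sum => i _; rewrite ffunE.
apply: ler_sum => p pIC.
pose V (s : xspace C * xspace C) : R := (C p)%:R - (s.1 p)%:R.
apply: le_trans (@hitting_time_bound _ _ q q_ge0 _ (@envelope I C) (hit p) V
  (delta C lambda mu p / Lambda C lambda mu) _ _ _ N s0) _.
- by move=> s; rewrite subr_ge0 ler_nat -ltnS ltn_ord.
- by rewrite divr_gt0// H2.
- move=> s sp; apply: lower_drift => //; rewrite ltn_neqAle.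
  apply/andP; split=> //.
  by rewrite -ltnS; exact: ltn_ord.
by rewrite invf_div mulrC /V ffunE /= subr0.
Qed.
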